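(* Let $T>0$. For every $f\in\mathcal{M}_T^{\mathrm{NV}}$ there exists a constant $C_f$, independent of $n\in\mathbb{N}$ and $\Delta t>0$, such that for all $n\in\mathbb{N}$ and $\Delta t>0$ with $n\Delta t\le T$, $$\lVert P_{n\Delta t}f-(Q^{\mathrm{NV}}_{(\Delta t)})^nf\rVert_{\psi_{\ell_0,s_0}}\le C_f\,\Delta t^2.$$
   Context: Setting. $X$ is a separable Hilbert space with norm $\lVert\cdot\rVert$; $A$ with domain $\operatorname{dom}A$ generates a strongly continuous pseudocontractive semigroup on $X$ (i.e. $\lVert e^{tA}\rVert\le e^{ct}$ for some $c\in\mathbb{R}$) and has compact resolvent. $\operatorname{dom}A^{\ell}$ is a Hilbert space with norm $\lVert x\rVert_{\operatorname{dom}A^{\ell}}:=(\sum_{k=0}^{\ell}\lVert A^kx\rVert^2)^{1/2}$ ($\operatorname{dom}A^0=X$). Let $m\ge 1$; $\alpha,\sigma_1,\dots,\sigma_d\colon X\to X$ are Lipschitz continuous on $X$ and also Lipschitz continuous $\operatorname{dom}A^{\ell}\to\operatorname{dom}A^{\ell}$ for $\ell=1,\dots,m$; the $\sigma_j$ are continuously differentiable with bounded first derivative. $(W^j_t)_{j=1,\dots,d}$ is a $d$-dimensional Brownian motion. $x(t,x_0)$ is the (mild) solution of $\mathrm{d}x(t,x_0)=(Ax(t,x_0)+\alpha(x(t,x_0)))\,\mathrm{d}t+\sum_{j=1}^d\sigma_j(x(t,x_0))\,\mathrm{d}W^j_t$, $x(0,x_0)=x_0$, and $P_tf(x_0):=\mathbb{E}[f(x(t,x_0))]$.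 With $\alpha_0(z):=\alpha(z)-\frac12\sum_{j=1}^dD\sigma_j(z)\sigma_j(z)$, $z^0(t,x_0)$ is the solution of $\frac{\mathrm{d}}{\mathrm{d}t}z^0=Az^0+\alpha_0(z^0)$, and for $j=1,\dots,d$, $z^j(t,x_0)$ solves the Stratonovich equation $\mathrm{d}z^j=\sigma_j(z^j)\circ\mathrm{d}W^j_t$, all started at $x_0$; $P^j_tf(x_0):=\mathbb{E}[f(z^j(t,x_0))]$, $j=0,\dots,d$. Function spaces. For $\ell\ge 0$, $s\ge 2$ let $\psi_{\ell,s}(x):=(1+\lVert x\rVert_{\operatorname{dom}A^{\ell}}^2)^{s/2}$ on $\operatorname{dom}A^{\ell}$. $(\operatorname{dom}A^{\ell})_w$ is $\operatorname{dom}A^{\ell}$ with its weak topology, and $\mathcal{B}^{\psi_{\ell,s}}((\operatorname{dom}A^{\ell})_w)$ is the closure of the bounded weakly continuous functions $\operatorname{dom}A^{\ell}\to\mathbb{R}$ with respect to $\lVert f\rVert_{\psi_{\ell,s}}:=\sup_x\psi_{\ell,s}(x)^{-1}|f(x)|$. Fix $\ell_0\in\{0,\dots,m-1\}$ and $s_0\ge 2$. $(P_t)$ and $(P^j_t)$, $j=0,\dots,d$, are regarded as strongly continuous semigroups on $\mathcal{B}^{\psi_{\ell_0,s_0}}((\operatorname{dom}A^{\ell_0})_w)$ with operator norms bounded by $e^{\omega t}$, $e^{\omega_jt}$ for some real constants (standing assumption). Their infinitesimal generators on this space are $\mathcal{G}$ and $\mathcal{G}_j$. The Ninomiya-Victoir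 splitting is $Q^{\mathrm{NV}}_{(\Delta t)}:=\frac12P^0_{\Delta t/2}\left(P^1_{\Delta t}\cdots P^d_{\Delta t}+P^d_{\Delta t}\cdots P^1_{\Delta t}\right)P^0_{\Delta t/2}$. $\mathcal{M}_T^{\mathrm{NV}}:=\mathcal{M}_T^3$, where for $q\ge 1$, $\mathcal{M}_T^{q}$ is the set of $f\in\mathcal{B}^{\psi_{\ell_0,s_0}}((\operatorname{dom}A^{\ell_0})_w)$ such that $P_tf\in\operatorname{dom}\mathcal{G}^q\cap\bigcap_{j=0}^d\operatorname{dom}\mathcal{G}_j^q$ for $t\in[0,T]$, $\sup_{t\in[0,T],\,j_1,\dots,j_q\in\{0,\dots,d\}}\lVert\mathcal{G}_{j_1}\cdots\mathcal{G}_{j_q}P_tf\rVert_{\psi_{\ell_0,s_0}}<\infty$ (in particular these compositions are defined), and $\mathcal{G}^iP_tf=(\sum_{j=0}^d\mathcal{G}_j)^iP_tf$ for $i=1,\dots,q$, $t\in[0,T]$. *)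

(* Defs.v *)
From HB Require Import structures.
From mathcomp Require Import all_boot all_order all_algebra.
From mathcomp Require Import all_classical all_reals all_analysis.

Set Implicit Arguments.
Unset Strict Implicit.
Unset Printing Implicit Defensive.
Import Order.TTheory GRing.Theory Num.Theory.
Import numFieldNormedType.Exports.
Local Open Scope classical_set_scope.
Local Open Scope ring_scope.

(** Unbounded operators on [V] are represented by their graphs. *)
Section Operators.
Variables (R : realType) (V : lmodType R).

Definition operator := V -> V -> Prop.

Definition op_comp (a b : operator) : operator :=
  fun f h => exists2 g, b f g & a g h.

Definition op_prod (s : seq operator) : operator := foldr op_comp eq s.

Definition op_pow (a : operator) (q : nat) : operator := op_prod (nseq q a).

Definition op_sum (k : nat) (a : 'I_k -> operator) : operator :=
  fun f h => exists2 g : 'I_k -> V, (forall j, a j f (g j)) & h = \sum_j g j.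

Definition op_dom (a : operator) : set V := [set f | exists h, a f h].

(* The normed space is a subspace [B] of [V], with an extended-valued norm [N]
   that is finite on [B]; [P] only matters at nonnegative times and on [B]. *)
Variables (N : V -> \bar R) (B : set V).

Definition is_C0_semigroup (P : R -> V -> V) : Prop :=
  [/\ forall (t : R) f, 0 <= t -> B f -> B (P t f),
      forall (t a : R) f g, 0 <= t -> B f -> B g ->
        P t (a *: f + g) = a *: P t f + P t g,
      forall f, B f -> P 0 f = f,
      forall (s t : R) f, 0 <= s -> 0 <= t -> B f -> P (s + t) f = P s (P t f)
    & forall f, B f -> N (P t f - f) @[t --> 0^'+] --> 0%E].

Definition is_pseudocontractive_semigroup (P : R -> V -> V) : Prop :=
  is_C0_semigroup P /\
  exists omega : R, forall (t : R) f, 0 <= t -> B f ->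
    (N (P t f) <= (expR (omega * t))%:E * N f)%E.

Definition generator (P : R -> V -> V) : operator := fun f g =>
  [/\ B f, B g & N (t^-1 *: (P t f - f) - g) @[t --> 0^'+] --> 0%E].

(* The set of initial values for which the splitting of [P] (generator [G])
   along the generators [Gs j] is smooth up to order [q] on [0, T]. *)
Definition smooth_set (P : R -> V -> V) (k : nat) (Ps : 'I_k -> R -> V -> V)
    (T : R) (q : nat) : set V :=
  let G := generator P in
  let Gs := fun j => generator (Ps j) in
  [set f | [/\ B f,
      forall t : R, 0 <= t <= T -> op_dom (op_pow G q) (P t f) /\
        forall j, op_dom (op_pow (Gs j) q) (P t f),
      exists K : R, forall t : R, 0 <= t <= T -> forall js : q.-tuple 'I_k,
        exists2 h, op_prod [seq Gs j | j <- js] (P t f) h & (N h <= K%:E)%E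
    & forall i (t : R), (1 <= i <= q)%N -> 0 <= t <= T ->
        exists2 h, op_pow G i (P t f) h & op_pow (op_sum Gs) i (P t f) h]].

Definition ninomiya_victoir (d : nat) (Ps : 'I_d.+1 -> R -> V -> V) (dt : R)
    (f : V) : V :=
  let P0 := Ps ord0 (dt / 2) in
  let steps := [seq Ps (lift ord0 j) dt | j <- enum 'I_d] in
  let comp := fun s : seq (V -> V) => foldr (fun a b => a \o b) id s in
  2^-1 *: P0 (comp steps (P0 f) + comp (rev steps) (P0 f)).

End Operators.

Section Hilbert.
Variables (R : realType) (X : completeNormedModType R).

Definition is_hilbert : Prop := exists ip : X -> X -> R,
  [/\ forall a x y z, ip (a *: x + y) z = a * ip x z + ip y z,
      forall x y, ip x y = ip y x
    & forall x, ip x x = `|x| ^+ 2].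

Definition is_separable : Prop := exists2 D : set X, countable D & dense D.

Definition normE (x : X) : \bar R := `|x|%:E.

(* [A] is a partially defined operator with domain [D]; its values outside
   [D] are irrelevant. *)
Definition generates (A : X -> X) (D : set X) (S : R -> X -> X) : Prop :=
  forall x y, generator normE setT S x y <-> (D x /\ A x = y).

Definition has_compact_resolvent (A : X -> X) (D : set X) : Prop :=
  exists (lambda : R) (res : X -> X),
    [/\ forall x, D (res x) /\ lambda *: res x - A (res x) = x,
        forall x, D x -> res (lambda *: x - A x) = x
      & compact (closure (res @` [set x | `|x| <= 1]))].

Fixpoint dom_pow (A : X -> X) (D : set X) (l : nat) : set X :=
  if l is l'.+1 then [set x | D x /\ dom_pow A D l' (A x)] else setT.

Definition norm_pow (A : X -> X) (l : nat) (x : X) : R :=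
  Num.sqrt (\sum_(k < l.+1) `|iter k A x| ^+ 2).

Definition lipschitz_dom_pow (A : X -> X) (D : set X) (l : nat)
    (f : X -> X) : Prop :=
  (forall x, dom_pow A D l x -> dom_pow A D l (f x)) /\
  exists L : R, forall x y, dom_pow A D l x -> dom_pow A D l y ->
    norm_pow A l (f x - f y) <= L * norm_pow A l (x - y).

Definition C1_bounded_derivative (f : X -> X) : Prop :=
  [/\ forall x, differentiable f x,
      forall x (e : R), 0 < e -> \forall y \near x,
        forall h, `|'d f y h - 'd f x h| <= e * `|h|
    & exists M : R, forall x h, `|'d f x h| <= M * `|h|].

Definition psi (A : X -> X) (l : nat) (s : R) (x : X) : R :=
  (1 + norm_pow A l x ^+ 2) `^ (s / 2).

Definition is_functional (A : X -> X) (D : set X) (l : nat)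
    (phi : X -> R) : Prop :=
  (forall (a : R) x y, dom_pow A D l x -> dom_pow A D l y ->
     phi (a *: x + y) = a * phi x + phi y) /\
  exists M : R, forall x, dom_pow A D l x -> `|phi x| <= M * norm_pow A l x.

(* Continuity for the weak topology of [dom A^l], through its basic
   neighbourhoods. *)
Definition weakly_continuous (A : X -> X) (D : set X) (l : nat)
    (g : X -> R) : Prop :=
  forall x (e : R), dom_pow A D l x -> 0 < e ->
  exists (phis : seq (X -> R)) (delta : R),
    [/\ 0 < delta,
        forall i, (i < size phis)%N -> is_functional A D l (nth (cst 0) phis i)
      & forall y, dom_pow A D l y ->
          (forall i, (i < size phis)%N ->
             `|nth (cst 0) phis i y - nth (cst 0) phis i x| < delta) ->
          `|g y - g x| < e].

(* Functions on [dom A^l] are represented by their extension by zero to [X]. *)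
Definition wnorm (A : X -> X) (D : set X) (l : nat) (s : R)
    (f : X -> R^o) : \bar R :=
  ereal_sup [set ((psi A l s x)^-1 * `|f x|)%:E | x in dom_pow A D l].

Definition Bpsi (A : X -> X) (D : set X) (l : nat) (s : R) :
    set (X -> R^o) :=
  [set f | (forall x, ~ dom_pow A D l x -> f x = 0) /\
     forall e : R, 0 < e -> exists g : X -> R^o,
       [/\ exists M : R, forall x, dom_pow A D l x -> `|g x| <= M,
           weakly_continuous A D l g
         & (wnorm A D l s (f - g)%R <= e%:E)%E]].

(** Sums and step functions over a partition [0 = t_0 < ... < t_k], where
    [s] lists [t_1, ..., t_k]. *)
Definition step_fun (s : seq R) (h : nat -> X) (r : R) : X :=
  \sum_(i < size s) (\1_(`](0 :: s)`_i, s`_i] : set R) r : R) *: h i.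

Definition step_sum (G : R -> R) (s : seq R) (h : nat -> X) : X :=
  \sum_(i < size s) (G s`_i - G (0 :: s)`_i) *: h i.

(* [v] is the Bochner integral of [f] over [0, t]. *)
Definition is_time_integral (t : R) (f : R -> X) (v : X) : Prop :=
  exists (s : nat -> seq R) (h : nat -> nat -> X),
    [/\ forall n, itv_partition 0 t (s n),
        (\int[lebesgue_measure]_(r in `[0%R, t])
           `|step_fun (s n) (h n) r - f r|%R%:E)%E @[n --> \oo] --> 0%E
      & step_sum id (s n) (h n) @[n --> \oo] --> v].

Definition continuous_path (z : R -> X) : Prop :=
  {within [set t | 0 <= t], continuous z}.

(* Mild solution of dz/dt = A z + b(z), z(0) = x0, where [S] is the semigroup
   generated by [A]. *)
Definition is_mild_ode_solution (S : R -> X -> X) (b : X -> X) (x0 : X)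
    (z : R -> X) : Prop :=
  continuous_path z /\
  forall t : R, 0 <= t ->
    is_time_integral t (fun r => S (t - r) (b (z r))) (z t - S t x0).

Definition stratonovich_drift (d : nat) (alpha : X -> X)
    (sigma : 'I_d -> X -> X) (z : X) : X :=
  alpha z - 2^-1 *: \sum_j 'd (sigma j) z (sigma j z).

End Hilbert.

Section Stochastic.
Variables (R : realType) (disp : measure_display) (Omega : measurableType disp).
Variables (Pr : probability Omega R) (X : completeNormedModType R).

Definition is_filtration (F : R -> set (set Omega)) : Prop :=
  [/\ forall t : R, 0 <= t -> sigma_algebra setT (F t),
      forall t : R, 0 <= t -> F t `<=` measurable
    & forall s t : R, 0 <= s -> s <= t -> F s `<=` F t].

(* The last clause says that W_t - W_s is independent of F_s and normally
   distributed with covariance (t - s) times the identity. *)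
Definition is_brownian_motion (d : nat) (F : R -> set (set Omega))
    (W : 'I_d -> R -> Omega -> R) : Prop :=
  [/\ {ae Pr, forall w, forall j, W j 0 w = 0},
      {ae Pr, forall w, forall j,
         {within [set t | 0 <= t], continuous (fun t => W j t w)}},
      forall j (t : R) (U : set R), 0 <= t -> measurable U -> F t (W j t @^-1` U)
    & forall s t : R, 0 <= s -> s < t ->
        forall (E : set Omega) (U : 'I_d -> set R), F s E ->
        (forall j, measurable (U j)) ->
        Pr (E `&` [set w | forall j, U j (W j t w - W j s w)]) =
        (Pr E * \prod_(j < d) normal_prob 0 (Num.sqrt (t - s)) (U j))%E].

Definition cvg0_in_probability (Y : nat -> Omega -> \bar R) : Prop :=
  forall e : R, 0 < e -> \forall n \near \oo,
    exists E : set Omega,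
      [/\ measurable E, (Pr E <= e%:E)%E
        & forall w, ~ E w -> (Y n w < e%:E)%E].

Definition borel_wrt (G : set (set Omega)) (h : Omega -> X) : Prop :=
  forall U : set X, open U -> G (h @^-1` U).

Definition is_adapted_continuous (F : R -> set (set Omega))
    (x : R -> Omega -> X) : Prop :=
  (forall t : R, 0 <= t -> borel_wrt (F t) (x t)) /\
  {ae Pr, forall w, continuous_path (fun t => x t w)}.

(* [Y] is the Ito integral of [H] over [0, t] against [W]: the limit in
   probability of the integrals of bounded adapted step processes [H_n] such
   that the integral of |H_n - H|^2 over [0, t] tends to 0 in probability. *)
Definition is_ito_integral (F : R -> set (set Omega)) (W : R -> Omega -> R)
    (t : R) (H : R -> Omega -> X) (Y : Omega -> X) : Prop :=
  exists (s : nat -> seq R) (h : nat -> nat -> Omega -> X),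
    [/\ forall n, itv_partition 0 t (s n),
        forall n i, (i < size (s n))%N ->
          borel_wrt (F (0 :: s n)`_i) (h n i) /\
          exists M : R, forall w, `|h n i w| <= M,
        cvg0_in_probability (fun n w =>
          (\int[lebesgue_measure]_(r in `[0%R, t])
             (`|step_fun (s n) (fun i => h n i w) r - H r w| ^+ 2)%R%:E)%E)
      & cvg0_in_probability (fun n w =>
          normE (step_sum (fun r => W r w) (s n) (fun i => h n i w) - Y w))].

(* [Y] is the Stratonovich integral of [H] over [0, t] against [W]: the limit
   in probability of trapezoidal sums as the mesh tends to 0. *)
Definition is_stratonovich_integral (W : R -> Omega -> R) (t : R)
    (H : R -> Omega -> X) (Y : Omega -> X) : Prop :=
  forall s : nat -> seq R, (forall n, itv_partition 0 t (s n)) ->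
  (forall e : R, 0 < e -> \forall n \near \oo,
     forall i, (i < size (s n))%N -> (s n)`_i - (0 :: s n)`_i < e) ->
  cvg0_in_probability (fun n w =>
    normE (step_sum (fun r => W r w) (s n)
             (fun i => 2^-1 *: (H (0 :: s n)`_i w + H (s n)`_i w)) - Y w)).

(* Mild solution of dx = (A x + alpha(x)) dt + \sum_j sigma_j(x) dW^j,
   x(0) = x0, where [S] is the semigroup generated by [A]. *)
Definition is_mild_solution (d : nat) (F : R -> set (set Omega))
    (W : 'I_d -> R -> Omega -> R) (S : R -> X -> X) (alpha : X -> X)
    (sigma : 'I_d -> X -> X) (x0 : X) (x : R -> Omega -> X) : Prop :=
  is_adapted_continuous F x /\
  forall t : R, 0 <= t -> exists Y : 'I_d -> Omega -> X,
    (forall j, is_ito_integral F (W j) t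
       (fun r w => S (t - r) (sigma j (x r w))) (Y j)) /\
    {ae Pr, forall w,
       is_time_integral t (fun r => S (t - r) (alpha (x r w)))
         (x t w - S t x0 - \sum_j Y j w)}.

(* Solution of dz = sigma(z) o dW, z(0) = x0. *)
Definition is_stratonovich_solution (F : R -> set (set Omega))
    (W : R -> Omega -> R) (sigma : X -> X) (x0 : X) (z : R -> Omega -> X) :
    Prop :=
  is_adapted_continuous F z /\
  forall t : R, 0 <= t ->
    is_stratonovich_integral W t (fun r w => sigma (z r w))
      (fun w => z t w - x0).

(* P_t f(x0) = E[f(x(t, x0))] on the state space [E], zero outside [E]. *)
Definition transition (E : set X) (x : R -> X -> Omega -> X) (t : R)
    (f : X -> R^o) : X -> R^o :=
  fun x0 => if x0 \in E then fine ('E_Pr[fun w => f (x t x0 w)])%E else 0.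

(* Index 0 is the deterministic flow, index j >= 1 the flow along sigma_j. *)
Definition split_transition (E : set X) (d : nat) (z0 : R -> X -> X)
    (z : 'I_d -> R -> X -> Omega -> X) (j : 'I_d.+1) :
    R -> (X -> R^o) -> (X -> R^o) :=
  if unlift ord0 j is Some i then transition E (z i)
  else transition E (fun t x0 _ => z0 t x0).

End Stochastic.

(* Main.v *)
Require Import Defs.
From HB Require Import structures.
From mathcomp Require Import all_boot all_order all_algebra.
From mathcomp Require Import all_classical all_reals all_analysis.
From mathcomp Require Import ring lra.
Import Order.TTheory GRing.Theory Num.Theory.
Import numFieldNormedType.Exports.
Local Open Scope classical_set_scope.
Local Open Scope ring_scope.

(** The estimate is a fact about strongly continuous semigroups on a normed
    space: once the weighted space is known to be one
    ([Bpsi_normed_subspace]), the stochastic equation enters only through the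
    semigroups that it defines, and the theorem is
    [ninomiya_victoir_order2].

    The error after [n] steps telescopes into [n] local errors, each
    transported by powers of the splitting operator
    ([telescoping_error]).  One splitting step has norm at most
    [exp (Om (d + 1) dt)], so that its powers stay bounded while [n dt <= T],
    and a local error of order [dt ^ 3] gives a global error of order
    [dt ^ 2].

    For the local error, let [u] be one of the values [P_t f].  A product of
    semigroups is described by a word of pairs (index, time), and expanding
    each factor by Taylor's formula gives, up to a remainder of third order,
      [u + \sum_i lambda_i G_i u + \sum_(i, j) mu_ij G_i G_j u],
    where [lambda_i] is the total time spent along [G_i] ([flow_taylor]).
    The coefficients satisfy the shuffle relation
    [mu_ij + mu_ji = lambda_i lambda_j] ([weight2_shuffle]), and reversing a
    word transposes [mu] ([weight2_rev]).  The two products in the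
    Ninomiya-Victoir step are reversals of each other, because the outer half
    steps are symmetric; hence the second order coefficients of their average
    are [lambda_i lambda_j / 2].  As every [lambda_i] equals [dt], this is the
    expansion
      [u + dt (\sum_i G_i) u + dt ^ 2 / 2 (\sum_i G_i) ^ 2 u]
    of [P_dt u], since [\sum_i G_i] agrees with the generator of [P] on these
    elements.

    Taylor's formula is proved without an integral in the normed space:
    [norm_close_euler] cuts the time interval into small steps and sums the
    defects, which is a discrete form of the mean value inequality. *)

(** * Approximation in a normed subspace *)

Section NormedSubspace.
Set Implicit Arguments.
Unset Strict Implicit.
Unset Printing Implicit Defensive.
Variables (R : realType) (V : lmodType R).
Implicit Types (N : V -> \bar R) (B : set V) (u v w : V) (a b c e : R).

Definition norm_le N u c : Prop := (N u <= c%:E)%E.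

(** [N] may be infinite outside [B], so the axioms speak of real upper bounds
    instead of sums and products of extended reals. *)
Record normed_subspace N B : Prop := NormedSubspace {
  norm_leD : forall u v a b,
    norm_le N u a -> norm_le N v b -> norm_le N (u + v) (a + b);
  norm_leZ : forall c u a, norm_le N u a -> norm_le N (c *: u) (`|c| * a);
  norm_finite : forall u, B u -> exists a, norm_le N u a;
  norm_separates : forall u, B u -> norm_le N u 0 -> u = 0;
  subspace0 : B 0;
  subspaceP : forall c u v, B u -> B v -> B (c *: u + v) }.

Variables (N : V -> \bar R) (B : set V) (NB : normed_subspace N B).

(** Estimates are chained as approximations of one vector by another: this
    keeps the algebra of each step apart from the bookkeeping of errors. *)
Definition norm_close u v c : Prop := norm_le N (u - v) c.

Lemma norm_le_trans u a b : a <= b -> norm_le N u a -> norm_le N u b.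
Proof. by move=> ab Nu; apply: le_trans Nu _; rewrite lee_fin. Qed.

Lemma norm_le_lim u a : (forall e, 0 < e -> norm_le N u (a + e)) -> norm_le N u a.
Proof. by move=> Nu; apply/lee_addgt0Pr => e /Nu; rewrite -EFinD. Qed.

Lemma norm_le0 : norm_le N 0 0.
Proof.
have [a Na] := norm_finite NB (subspace0 NB).
by have := norm_leZ NB 0 Na; rewrite scale0r normr0 mul0r.
Qed.

Lemma norm_le_pos u : B u -> exists2 c, 0 <= c & norm_le N u c.
Proof.
move=> /(norm_finite NB) [a Na]; exists (Num.max a 0); first by rewrite le_max lexx orbT.
by apply: norm_le_trans Na; rewrite le_max lexx.
Qed.

Lemma norm_close_refl u : norm_close u u 0.
Proof. by rewrite /norm_close subrr; exact: norm_le0. Qed.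

Lemma norm_close_sym u v c : norm_close u v c -> norm_close v u c.
Proof.
by move=> /(norm_leZ NB (-1)); rewrite scaleN1r opprB normrN1 mul1r.
Qed.

Lemma norm_close_trans v u w a b : norm_close u v a -> norm_close v w b -> norm_close u w (a + b).
Proof. by move=> h1 h2; have := norm_leD NB h1 h2; rewrite addrA subrK. Qed.

Lemma norm_close_le u v a b : a <= b -> norm_close u v a -> norm_close u v b.
Proof. exact: norm_le_trans. Qed.

Lemma norm_closeD u u' v v' a b :
  norm_close u v a -> norm_close u' v' b -> norm_close (u + u') (v + v') (a + b).
Proof.
by move=> h1 h2; have := norm_leD NB h1 h2; rewrite addrACA -opprD.
Qed.

Lemma norm_closeZ c u v a : 0 <= c -> norm_close u v a -> norm_close (c *: u) (c *: v) (c * a).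
Proof. by move=> c0 /(norm_leZ NB c); rewrite scalerBr ger0_norm. Qed.

Lemma norm_close_sum (I : finType) (c : I -> R) (u v : I -> V) a :
  (forall i, 0 <= c i) -> (forall i, norm_close (u i) (v i) a) ->
  norm_close (\sum_i c i *: u i) (\sum_i c i *: v i) ((\sum_i c i) * a).
Proof.
move=> c0 uv; rewrite mulr_suml.
elim/big_rec3 : _ => [|i x y z _ IH]; first exact: norm_close_refl.
by apply: norm_closeD => //; exact: norm_closeZ.
Qed.

Lemma norm_le_sum (I : finType) (u : I -> V) (c : I -> R) :
  (forall i, norm_le N (u i) (c i)) -> norm_le N (\sum_i u i) (\sum_i c i).
Proof.
move=> uc; elim/big_rec2 : _ => [|i x y _ IH]; first exact: norm_le0.
by apply: (norm_leD NB) => //; exact: uc.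
Qed.

Lemma norm_close_eq u v : B u -> B v -> norm_close u v 0 -> u = v.
Proof.
move=> Bu Bv uv; apply/eqP; rewrite -subr_eq0; apply/eqP.
apply: (norm_separates NB) uv.
by rewrite addrC -scaleN1r; exact: (subspaceP NB).
Qed.

Lemma subspaceZ c u : B u -> B (c *: u).
Proof. by move=> Bu; rewrite -[_ *: _]addr0; apply: (subspaceP NB) => //; exact: (subspace0 NB). Qed.

Lemma subspaceD u v : B u -> B v -> B (u + v).
Proof. by move=> Bu Bv; rewrite -[u]scale1r; exact: (subspaceP NB). Qed.

Lemma subspace_sum (I : finType) (c : I -> R) (u : I -> V) :
  (forall i, B (u i)) -> B (\sum_i c i *: u i).
Proof.
move=> Bu; elim/big_rec : _ => [|i x _ IH]; first exact: (subspace0 NB).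
exact: (subspaceP NB).
Qed.

(** * Taylor's formula for a semigroup *)

Variable Om : R.

Record exp_bounded_semigroup (P : R -> V -> V) : Prop := ExpBoundedSemigroup {
  semigroup_C0 : is_C0_semigroup N B P;
  semigroup_bound : forall t u c, 0 <= t -> B u -> 0 <= c -> norm_le N u c ->
    norm_le N (P t u) (expR (Om * t) * c) }.

Section OneSemigroup.
Variables (P : R -> V -> V) (hP : exp_bounded_semigroup P).

Lemma semigroup_sub t u : 0 <= t -> B u -> B (P t u).
Proof. by case: (semigroup_C0 hP) => H _ _ _ _; exact: H. Qed.

Lemma semigroup_lin t c u v : 0 <= t -> B u -> B v ->
  P t (c *: u + v) = c *: P t u + P t v.
Proof. by case: (semigroup_C0 hP) => _ H _ _ _; exact: H. Qed.

Lemma semigroup_at0 u : B u -> P 0 u = u.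
Proof. by case: (semigroup_C0 hP) => _ _ H _ _; exact: H. Qed.

Lemma semigroup_add s t u : 0 <= s -> 0 <= t -> B u -> P (s + t) u = P s (P t u).
Proof. by case: (semigroup_C0 hP) => _ _ _ H _; exact: H. Qed.

Lemma semigroup_zero t : 0 <= t -> P t 0 = 0.
Proof.
move=> t0; have B0 := subspace0 NB.
have := semigroup_lin 1 t0 B0 B0.
by rewrite !scale1r addr0 => /(congr1 (fun u => u - P t 0)); rewrite addrK subrr.
Qed.

Lemma semigroupD t u v : 0 <= t -> B u -> B v -> P t (u + v) = P t u + P t v.
Proof. by move=> t0 Bu Bv; have := semigroup_lin 1 t0 Bu Bv; rewrite !scale1r. Qed.

Lemma semigroupZ t c u : 0 <= t -> B u -> P t (c *: u) = c *: P t u.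
Proof.
move=> t0 Bu; have := semigroup_lin c t0 Bu (subspace0 NB).
by rewrite semigroup_zero // !addr0.
Qed.

Lemma semigroup_sum (I : finType) (c : I -> R) (u : I -> V) t :
  0 <= t -> (forall i, B (u i)) ->
  P t (\sum_i c i *: u i) = \sum_i c i *: P t (u i).
Proof.
move=> t0 Bu.
suff [] : P t (\sum_i c i *: u i) = \sum_i c i *: P t (u i) /\
    B (\sum_i c i *: u i) by [].
elim/big_rec2 : _ => [|i x y _ [IH By]].
  by split; [exact: semigroup_zero|exact: (subspace0 NB)].
by rewrite semigroup_lin // IH; split => //; apply: (subspaceP NB).
Qed.

Lemma semigroup_norm_close t u v c : 0 <= t -> B u -> B v -> 0 <= c ->
  norm_close u v c -> norm_close (P t u) (P t v) (expR (Om * t) * c).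
Proof.
move=> t0 Bu Bv c0 uv.
have E : P t (u - v) = P t u - P t v.
  by rewrite addrC -scaleN1r semigroup_lin // scaleN1r addrC.
rewrite /norm_close -E; apply: (semigroup_bound hP) => //.
by rewrite addrC -scaleN1r; exact: (subspaceP NB).
Qed.

(** The generator relation with its limit spelled out as an eventual upper
    bound.  In this form it passes to sums by the triangle inequality alone,
    whereas convergence of extended reals would also ask for lower bounds
    on [N]. *)
Definition derivative0 (u v : V) : Prop :=
  [/\ B u, B v & forall e, 0 < e ->
    \forall h \near 0^'+, norm_close (P h u) (u + h *: v) (e * h)].

End OneSemigroup.

Lemma derivative0_generator P u v : generator N B P u v -> derivative0 P u v.
Proof.
move=> [Bu Bv cv]; split => // e e0.
have e0' : (0 < e%:E)%E by rewrite lte_fin.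
have cve : \forall h \near 0^'+, (N (h^-1 *: (P h u - u) - v)%R < e%:E)%E.
  exact: cv _ (open_ereal_lt' e0').
near=> h.
have h0 : 0 < h by near: h; exact: nbhs_right_gt.
have : (N (h^-1 *: (P h u - u) - v)%R < e%:E)%E.
  by near: h; exact: cve.
move=> /ltW /(norm_leZ NB h); rewrite scalerBr scalerA divff ?gt_eqF// scale1r.
by rewrite /norm_close opprD addrA gtr0_norm// mulrC.
Unshelve. all: by end_near. Qed.

Lemma derivative0_uniq P u v w : derivative0 P u v -> derivative0 P u w -> v = w.
Proof.
move=> [Bu Bv hv] [_ Bw hw]; apply: norm_close_eq => //.
apply: norm_le_lim => e e0; rewrite add0r.
have e2 : 0 < e / 2 by rewrite divr_gt0.
near (0 : R)^'+ => h.
have h0 : 0 < h by near: h; exact: nbhs_right_gt.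
have uv : norm_close (P h u) (u + h *: v) (e / 2 * h) by near: h; exact: hv.
have uw : norm_close (P h u) (u + h *: w) (e / 2 * h) by near: h; exact: hw.
have h00 : 0 <= h^-1 by rewrite invr_ge0 ltW.
have := norm_closeZ h00 (norm_close_trans (norm_close_sym uv) uw).
rewrite -mulrDl -splitr mulrCA mulVf ?gt_eqF// mulr1 /norm_close -scalerBr.
by rewrite opprD addrACA subrr add0r -scalerBr scalerA mulVf ?gt_eqF// scale1r.
Unshelve. all: by end_near. Qed.

Lemma derivative0_sum P (I : finType) (u v : I -> V) :
  exp_bounded_semigroup P -> (forall i, derivative0 P (u i) (v i)) ->
  derivative0 P (\sum_i u i) (\sum_i v i).
Proof.
move=> hP uv; elim/big_rec2 : _ => [|i x y _ [Bx By xy]].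
  have B0 := subspace0 NB; split => // e e0; near=> h.
  have h0 : 0 < h by near: h; exact: nbhs_right_gt.
  rewrite (semigroup_zero hP) ?ltW// scaler0 addr0.
  apply: norm_close_le (norm_close_refl _); exact/ltW/mulr_gt0.
have [Bu Bv uvi] := uv i.
split => [||e e0]; [exact: subspaceD|exact: subspaceD|].
have e2 : 0 < e / 2 by rewrite divr_gt0.
near=> h.
have h0 : 0 < h by near: h; exact: nbhs_right_gt.
rewrite (semigroupD hP) ?ltW// scalerDr addrACA [e]splitr mulrDl.
apply: norm_closeD; near: h; [exact: uvi|exact: xy].
Unshelve. all: by end_near. Qed.

Hypothesis Om_ge0 : 0 <= Om.

Lemma expR_mono s t : s <= t -> expR (Om * s) <= expR (Om * t).
Proof. by move=> st; rewrite ler_expR ler_wpM2l. Qed.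

Section Taylor.
Variables (P : R -> V -> V) (hP : exp_bounded_semigroup P).

(** An Euler scheme for [P _ u] with step [h]: each step replaces [P h u] by
    [u + h v] and the slope [P s v] by [a + s b].  The coefficient of [b] is the
    left Riemann sum of [s] over the [n] steps. *)
Lemma norm_close_euler u v (a b : V) (t h e M : R) (n : nat) :
  B u -> B v -> 0 <= h -> 0 <= e -> n%:R * h <= t ->
  norm_close (P h u) (u + h *: v) (e * h) ->
  (forall s, 0 <= s <= t -> norm_close (P s v) (a + s *: b) M) ->
  norm_close (P (n%:R * h) u)
    (u + (n%:R * h) *: a + (h ^+ 2 * (n%:R * (n%:R - 1) / 2)) *: b)
    (n%:R * h * (expR (Om * t) * e + M)).
Proof.
move=> Bu Bv h0 e0 + Ph Pv; elim: n => [_|n IH nt].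
  rewrite !mul0r mulr0 !scale0r !addr0 (semigroup_at0 hP)//.
  exact: norm_close_refl.
have nh0 : 0 <= n%:R * h by rewrite mulr_ge0.
have nht : n%:R * h <= t by rewrite (le_trans _ nt)// ler_wpM2r// ler_nat.
have {}IH := IH nht.
have Pnh : norm_close (P (n%:R * h) (P h u))
    (P (n%:R * h) u + h *: P (n%:R * h) v) (expR (Om * t) * e * h).
  rewrite -(semigroupZ hP)// -(semigroupD hP)//; last exact: subspaceZ.
  apply: (@norm_close_le _ _ (expR (Om * (n%:R * h)) * (e * h))).
    by rewrite -mulrA ler_wpM2r ?mulr_ge0// expR_mono.
  apply: (semigroup_norm_close hP) => //; last by rewrite mulr_ge0.
    exact: (semigroup_sub hP).
  by apply: subspaceD => //; exact: subspaceZ.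
have nht' : 0 <= n%:R * h <= t by rewrite nh0.
have := norm_close_trans Pnh (norm_closeD IH (norm_closeZ h0 (Pv _ nht'))).
rewrite -(semigroup_add hP)// -[n.+1%:R]natr1.
have -> : (n%:R + 1) * h = n%:R * h + h by ring.
have -> : h ^+ 2 * ((n%:R + 1) * (n%:R + 1 - 1) / 2) =
  h ^+ 2 * (n%:R * (n%:R - 1) / 2) + h * (n%:R * h) by field.
rewrite 2!scalerDl scalerDr scalerA addrACA -(addrA u).
by apply: norm_close_le; rewrite le_eqVlt; apply/orP; left; apply/eqP; ring.
Qed.

(** Integrating an affine approximation of the derivative of [P t u]: let the
    step of the Euler scheme tend to 0.  Each order of Taylor's formula follows
    from the previous one in this way. *)
Lemma norm_close_integral u v (a b : V) t M :
  derivative0 P u v -> B b -> 0 <= t -> 0 <= M ->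
  (forall s, 0 <= s <= t -> norm_close (P s v) (a + s *: b) M) ->
  norm_close (P t u) (u + t *: a + (t ^+ 2 / 2) *: b) (t * M).
Proof.
move=> [Bu Bv uv] Bb; rewrite le_eqVlt => /predU1P[<- _ _|t0 M0 Pv].
  rewrite expr0n /= !mul0r !scale0r !addr0 (semigroup_at0 hP)//.
  exact: norm_close_refl.
have [c c0 bc] := norm_le_pos Bb.
apply: norm_le_lim => e e0.
pose E := expR (Om * t); have E0 : 0 < E by exact: expR_gt0.
(* Half of [e] pays for the local defects of the Euler scheme, and half for the
   difference between the Riemann sum and [t ^+ 2 / 2]. *)
pose e1 := e / 2 / (t * E); have e10 : 0 < e1 by rewrite !divr_gt0// mulr_gt0.
pose r := e / (t * (c + 1)).
have r0 : 0 < r by rewrite divr_gt0// mulr_gt0// ltr_wpDl.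
have /nbhs_ballP[d /= d0 hd] :
    \forall h \near 0, 0 < h -> norm_close (P h u) (u + h *: v) (e1 * h) /\ h < r.
  by apply: (@filterI _ (0^'+ : set_system R)); [exact: uv|exact: nbhs_right_lt].
have dt0 : 0 < d / t by rewrite divr_gt0.
near \oo => n; pose h := t / n.+1%:R.
have h0 : 0 < h by rewrite divr_gt0.
have hd' : h < d.
  rewrite /h -ltr_pdivlMl// mulrC.
  by near: n; exact: (near_infty_natSinv_lt (PosNum dt0)).
have [] := hd h; rewrite /ball/= ?sub0r ?normrN ?gtr0_norm// => Ph hr.
have nh : n.+1%:R * h = t by rewrite mulrC divfK.
have := norm_close_euler Bu Bv (ltW h0) (ltW e10) _ Ph Pv.
move=> /(_ n.+1); rewrite nh lexx => /(_ isT) cl.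
have bb : norm_close ((h ^+ 2 * (n.+1%:R * (n.+1%:R - 1) / 2)) *: b)
                ((t ^+ 2 / 2) *: b) (t * h / 2 * c).
  rewrite /norm_close -scalerBl.
  have -> : h ^+ 2 * (n.+1%:R * (n.+1%:R - 1) / 2) - t ^+ 2 / 2 = - (t * h / 2).
    by rewrite -nh; ring.
  have := norm_leZ NB (- (t * h / 2)) bc.
  by rewrite normrN ger0_norm// divr_ge0// mulr_ge0// ltW.
have := norm_close_trans cl (norm_closeD (norm_close_refl (u + t *: a)) bb).
apply: norm_close_le; rewrite add0r mulrDr addrAC.
have -> : t * (expR (Om * t) * e1) = e / 2.
  by rewrite /e1 -/E; field; rewrite !gt_eqF.
rewrite [leLHS]addrC lerD2l [leRHS]splitr lerD2l.
have := ltW hr; rewrite /r ler_pdivlMr ?mulr_gt0 ?ltr_wpDl// => hr'.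
have : 0 <= t * h by rewrite mulr_ge0// ltW.
by move=> ?; nra.
Unshelve. all: by end_near. Qed.

Lemma taylor_order1 u v t c : derivative0 P u v -> 0 <= t -> 0 <= c ->
  norm_le N v c -> norm_close (P t u) u (t * (expR (Om * t) * c)).
Proof.
move=> uv t0 c0 vc; have [Bu Bv _] := uv.
have := @norm_close_integral u v 0 0 t (expR (Om * t) * c) uv (subspace0 NB) t0.
rewrite !scaler0 !addr0; apply; first by rewrite mulr_ge0// expR_ge0.
move=> s /andP[s0 st]; rewrite /norm_close scaler0 addr0 subr0.
apply: (@norm_le_trans _ (expR (Om * s) * c)).
  by rewrite ler_wpM2r// expR_mono.
exact: (semigroup_bound hP).
Qed.

Lemma taylor_order2 u v w t c :
  derivative0 P u v -> derivative0 P v w -> 0 <= t -> 0 <= c ->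
  norm_le N w c ->
  norm_close (P t u) (u + t *: v) (t ^+ 2 * (expR (Om * t) * c)).
Proof.
move=> uv vw t0 c0 wc.
have := @norm_close_integral u v v 0 t (t * (expR (Om * t) * c)) uv (subspace0 NB) t0.
rewrite !scaler0 !addr0 mulrA -expr2; apply.
  by rewrite !mulr_ge0// expR_ge0.
move=> s /andP[s0 st]; rewrite scaler0 addr0.
have := taylor_order1 vw s0 c0 wc; apply: norm_close_le.
by rewrite ler_pM ?mulr_ge0 ?expR_ge0// ler_wpM2r// expR_mono.
Qed.

Lemma taylor_order3 u v w z t c :
  derivative0 P u v -> derivative0 P v w -> derivative0 P w z ->
  0 <= t -> 0 <= c -> norm_le N z c ->
  norm_close (P t u) (u + t *: v + (t ^+ 2 / 2) *: w) (t ^+ 3 * (expR (Om * t) * c)).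
Proof.
move=> uv vw wz t0 c0 zc; have [_ Bw _] := vw.
have := @norm_close_integral u v v w t (t ^+ 2 * (expR (Om * t) * c)) uv Bw t0.
rewrite mulrA -exprS; apply; first by rewrite !mulr_ge0 ?exprn_ge0// expR_ge0.
move=> s /andP[s0 st].
have := taylor_order2 vw wz s0 c0 zc; apply: norm_close_le.
rewrite ler_pM ?exprn_ge0 ?mulr_ge0 ?expR_ge0//; first by rewrite lerXn2r.
by rewrite ler_wpM2r// expR_mono.
Qed.

End Taylor.

End NormedSubspace.

(** * Coefficients of the expansion along a word *)

Section Words.
Set Implicit Arguments.
Unset Strict Implicit.
Unset Printing Implicit Defensive.
Variables (R : realType) (I : finType).
Implicit Types (w : seq (I * R)) (i j : I).

Definition duration w : R := \sum_(x <- w) x.2.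

(** The coefficients of degree one and two of the product of the exponential
    series of [a_x G_x] over the letters [x] of the word, the head of the word
    being the leftmost factor. *)
Definition weight1 w i : R := \sum_(x <- w) (x.1 == i)%:R * x.2.

Fixpoint weight2 w i j : R :=
  if w is x :: w' then
    weight2 w' i j +
    (x.1 == i)%:R * (x.2 * weight1 w' j + (x.1 == j)%:R * (x.2 ^+ 2 / 2))
  else 0.

Definition nonneg_word w := all (fun x => 0 <= x.2) w.

Lemma weight1_cons x w i :
  weight1 (x :: w) i = (x.1 == i)%:R * x.2 + weight1 w i.
Proof. by rewrite /weight1 big_cons. Qed.

Lemma duration_cons x w : duration (x :: w) = x.2 + duration w.
Proof. by rewrite /duration big_cons. Qed.

Lemma duration_ge0 w : nonneg_word w -> 0 <= duration w.
Proof.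
elim: w => [_|x w IH /= /andP[x0 /IH w0]]; first by rewrite /duration big_nil.
by rewrite duration_cons addr_ge0.
Qed.

Lemma weight1_ge0 w i : nonneg_word w -> 0 <= weight1 w i.
Proof.
elim: w => [_|x w IH /= /andP[x0 /IH w0]]; first by rewrite /weight1 big_nil.
by rewrite weight1_cons addr_ge0// mulr_ge0.
Qed.

Lemma weight2_ge0 w i j : nonneg_word w -> 0 <= weight2 w i j.
Proof.
elim: w => [//|x w IH /= /andP[x0 w0]].
rewrite addr_ge0 ?IH// mulr_ge0// addr_ge0// mulr_ge0 ?weight1_ge0//.
by rewrite divr_ge0// exprn_ge0.
Qed.

Lemma sum_delta (i : I) (f : I -> R) : \sum_j (i == j)%:R * f j = f i.
Proof.
rewrite (bigD1 i)//= eqxx mul1r big1 ?addr0// => j ji.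
by rewrite eq_sym (negbTE ji) mul0r.
Qed.

Lemma sum_weight1 w : \sum_i weight1 w i = duration w.
Proof.
rewrite /weight1 exchange_big /=; apply: eq_bigr => x _.
by rewrite (sum_delta x.1 (fun=> x.2)).
Qed.

(** A single exponential has [a^2/2 + a^2/2 = a * a], and multiplying by one
    more exponential preserves the relation: this is where the symmetric part of
    the second order coefficients is forced. *)
Lemma weight2_shuffle w i j :
  weight2 w i j + weight2 w j i = weight1 w i * weight1 w j.
Proof.
elim: w => [|x w IH] /=; first by rewrite /weight1 !big_nil addr0 mul0r.
by rewrite !weight1_cons mulrDl !mulrDr -IH; field.
Qed.

Lemma sum_weight2 w :
  \sum_(p : I * I) weight2 w p.1 p.2 = duration w ^+ 2 / 2.
Proof.
rewrite -(pair_bigA _ (fun i j => weight2 w i j)) /=.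
apply: (@mulIf _ 2) => //; rewrite divfK// mulr_natr mulr2n.
rewrite {2}exchange_big -big_split /= expr2 -sum_weight1 big_distrlr /=.
apply: eq_bigr => i _; rewrite -big_split /=.
by apply: eq_bigr => j _; rewrite weight2_shuffle.
Qed.

Lemma weight1_rev w i : weight1 (rev w) i = weight1 w i.
Proof. by rewrite /weight1; apply: perm_big; rewrite perm_rev. Qed.

Lemma duration_rev w : duration (rev w) = duration w.
Proof. by apply: perm_big; rewrite perm_rev. Qed.

Lemma weight2_rcons w x i j : weight2 (rcons w x) i j =
  weight2 w i j +
  (x.1 == j)%:R * (x.2 * weight1 w i + (x.1 == i)%:R * (x.2 ^+ 2 / 2)).
Proof.
elim: w => [|y w IH] /=; first by rewrite /weight1 !big_nil; ring.
by rewrite IH -cats1 /weight1 big_cat /= big_seq1 big_cons; ring.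
Qed.

Lemma weight2_rev w i j : weight2 (rev w) i j = weight2 w j i.
Proof.
by elim: w => [|x w IH] //=; rewrite rev_cons weight2_rcons IH weight1_rev.
Qed.

(** Averaging a product with its reversal leaves only the symmetric part, which
    does not depend on the order of the factors. *)
Lemma weight2_rev_average w i j :
  2^-1 * (weight2 w i j + weight2 (rev w) i j) =
  2^-1 * (weight1 w i * weight1 w j).
Proof. by rewrite weight2_rev weight2_shuffle. Qed.

End Words.

(** * Expansion of a product of semigroups *)

Section Flows.
Set Implicit Arguments.
Unset Strict Implicit.
Unset Printing Implicit Defensive.
Variables (R : realType) (V : lmodType R) (N : V -> \bar R) (B : set V).
Variables (NB : normed_subspace N B) (Om : R) (Om_ge0 : 0 <= Om).
Variables (I : finType) (Ps : I -> R -> V -> V).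
Hypothesis hPs : forall i, exp_bounded_semigroup N B Om (Ps i).
Implicit Types (w : seq (I * R)) (u v : V).

Definition flow w u : V := foldr (fun x v => Ps x.1 x.2 v) u w.

Lemma flow_sub w u : nonneg_word w -> B u -> B (flow w u).
Proof.
move=> + Bu; elim: w => [//|x w IH /= /andP[x0 /IH w0]].
exact: (semigroup_sub (hPs _)).
Qed.

Lemma flow_norm_close w u v c : nonneg_word w -> B u -> B v -> 0 <= c ->
  norm_close N u v c -> norm_close N (flow w u) (flow w v) (expR (Om * duration w) * c).
Proof.
move=> + Bu Bv c0 uv; elim: w => [_|x w IH /= /andP[x0 w0]].
  by rewrite /duration big_nil mulr0 expR0 mul1r.
rewrite duration_cons mulrDr expRD -mulrA.
apply: (semigroup_norm_close NB (hPs _)) => //.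
- exact: flow_sub.
- exact: flow_sub.
- by rewrite mulr_ge0// expR_ge0.
- exact: IH.
Qed.

(** The iterated images of [u] under the generators, up to order three; [D1 i]
    stands for [G_i u], [D2 i j] for [G_i G_j u], and so on. *)
Record jet3 (K : R) u (D1 : I -> V) (D2 : I -> I -> V)
    (D3 : I -> I -> I -> V) : Prop := Jet3 {
  jet_D1 : forall i, derivative0 N B (Ps i) u (D1 i);
  jet_D2 : forall i j, derivative0 N B (Ps i) (D1 j) (D2 i j);
  jet_D3 : forall i j k, derivative0 N B (Ps i) (D2 j k) (D3 i j k);
  jet_bound : forall i j k, norm_le N (D3 i j k) K }.

Definition taylor2 u (D1 : I -> V) (D2 : I -> I -> V) w : V :=
  u + \sum_i weight1 w i *: D1 i + \sum_(p : I * I) weight2 w p.1 p.2 *: D2 p.1 p.2.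

Lemma sum_deltaZ (i : I) (f : I -> V) : \sum_j (i == j)%:R *: f j = f i.
Proof.
rewrite (bigD1 i)//= eqxx scale1r big1 ?addr0// => j ji.
by rewrite eq_sym (negbTE ji) scale0r.
Qed.

Lemma taylor2_cons u D1 D2 x w : taylor2 u D1 D2 (x :: w) =
  (u + x.2 *: D1 x.1 + (x.2 ^+ 2 / 2) *: D2 x.1 x.1) +
  (\sum_i weight1 w i *: (D1 i + x.2 *: D2 x.1 i)) +
  \sum_(p : I * I) weight2 w p.1 p.2 *: D2 p.1 p.2.
Proof.
have S1 : \sum_i weight1 (x :: w) i *: D1 i =
    x.2 *: D1 x.1 + \sum_i weight1 w i *: D1 i.
  under eq_bigr do rewrite weight1_cons scalerDl -scalerA.
  by rewrite big_split /= (sum_deltaZ x.1 (fun i => x.2 *: D1 i)).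
have S2 : \sum_(p : I * I) weight2 (x :: w) p.1 p.2 *: D2 p.1 p.2 =
    \sum_(p : I * I) weight2 w p.1 p.2 *: D2 p.1 p.2 +
    (x.2 *: (\sum_j weight1 w j *: D2 x.1 j) + (x.2 ^+ 2 / 2) *: D2 x.1 x.1).
  under eq_bigr do rewrite /= scalerDl -scalerA.
  rewrite big_split /= -(pair_bigA _ (fun i j => (x.1 == i)%:R *:
    ((x.2 * weight1 w j + (x.1 == j)%:R * (x.2 ^+ 2 / 2)) *: D2 i j))) /=.
  congr (_ + _); under eq_bigr do rewrite -scaler_sumr.
  rewrite (sum_deltaZ x.1 (fun i => \sum_j
    ((x.2 * weight1 w j + (x.1 == j)%:R * (x.2 ^+ 2 / 2)) *: D2 i j))) /=.
  under eq_bigr do rewrite scalerDl -scalerA -[X in _ + X]scalerA.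
  rewrite big_split -scaler_sumr /=.
  by rewrite (sum_deltaZ x.1 (fun j => (x.2 ^+ 2 / 2) *: D2 x.1 j)).
have S3 : \sum_i weight1 w i *: (D1 i + x.2 *: D2 x.1 i) =
    \sum_i weight1 w i *: D1 i + x.2 *: (\sum_j weight1 w j *: D2 x.1 j).
  rewrite scaler_sumr -big_split /=; apply: eq_bigr => i _.
  by rewrite scalerDr !scalerA mulrC.
rewrite /taylor2 S1 S2 S3.
by rewrite [RHS](AC (3*2*1) (1*(2*4)*(6*(5*3)))).
Qed.

(** Induction on the word.  Applying one more semigroup, each term of degree [k]
    is expanded to order [2 - k], which leaves remainders of total order three;
    the bound closes because [t^3 + a^3 + t a^2 + t^2 a / 2 <= (a + t)^3]. *)
Lemma flow_taylor (K : R) u D1 D2 D3 w :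
  0 <= K -> B u -> jet3 K u D1 D2 D3 ->
  nonneg_word w ->
  norm_close N (flow w u) (taylor2 u D1 D2 w)
    (expR (Om * duration w) * K * duration w ^+ 3).
Proof.
move=> K0 Bu J; elim: w => [_|[i a] w IH /= /andP[/= a0 w0]].
  rewrite /taylor2 /duration big_nil expr0n /= mulr0.
  rewrite !big1 ?addr0 => [||j _].
  - exact: (norm_close_refl NB).
  - by move=> p _; rewrite scale0r.
  - by rewrite /weight1 big_nil scale0r.
have {}IH := IH w0; set t := duration w in IH *.
have t0 : 0 <= t by exact: duration_ge0.
have BD1 j : B (D1 j) by case: (jet_D1 J j).
have BD2 j k : B (D2 j k) by case: (jet_D2 J j k).
have BS1 : B (\sum_j weight1 w j *: D1 j) by exact: (subspace_sum NB).
have BS2 : B (\sum_(p : I * I) weight2 w p.1 p.2 *: D2 p.1 p.2).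
  by apply: (subspace_sum NB (fun p : I * I => weight2 w p.1 p.2)).
pose E := expR (Om * a); have E0 : 0 <= E by exact: expR_ge0.
have BuS1 : B (u + \sum_j weight1 w j *: D1 j) by exact: (subspaceD NB).
have step1 : norm_close N (Ps i a (flow w u)) (Ps i a (taylor2 u D1 D2 w))
    (E * (expR (Om * t) * K * t ^+ 3)).
  apply: (semigroup_norm_close NB (hPs i)) => //.
  - exact: flow_sub.
  - exact: (subspaceD NB).
  - by rewrite !mulr_ge0 ?exprn_ge0 ?expR_ge0.
rewrite /taylor2 !(semigroupD (hPs i))// !(semigroup_sum NB (hPs i))// in step1.
have c3 : norm_close N (Ps i a u) (u + a *: D1 i + (a ^+ 2 / 2) *: D2 i i)
    (a ^+ 3 * (E * K)).
  by apply: (taylor_order3 NB Om_ge0 (hPs i) _ _ (jet_D3 J i i i)) => //;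
    [exact: (jet_D1 J)|exact: (jet_D2 J)|exact: (jet_bound J)].
have c2 j : norm_close N (Ps i a (D1 j)) (D1 j + a *: D2 i j) (a ^+ 2 * (E * K)).
  by apply: (taylor_order2 NB Om_ge0 (hPs i) _ (jet_D3 J i i j)) => //;
    [exact: (jet_D2 J)|exact: (jet_bound J)].
have c1 (p : I * I) : norm_close N (Ps i a (D2 p.1 p.2)) (D2 p.1 p.2) (a * (E * K)).
  by apply: (taylor_order1 NB Om_ge0 (hPs i) (jet_D3 J i p.1 p.2)) => //;
    exact: (jet_bound J).
have s2 := norm_close_sum NB (fun j => weight1_ge0 j w0) c2.
have s1 := norm_close_sum NB (fun p : I * I => weight2_ge0 p.1 p.2 w0) c1.
rewrite sum_weight1 in s2; rewrite sum_weight2 in s1.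
have := norm_close_trans NB step1 (norm_closeD NB (norm_closeD NB c3 s2) s1).
rewrite taylor2_cons /= duration_cons /= -/t; apply: norm_close_le.
rewrite mulrDr expRD -/E; set F := expR (Om * t).
have F1 : 1 <= F by rewrite -expR0 ler_expR mulr_ge0.
have EK0 : 0 <= E * K by rewrite mulr_ge0.
apply: (@le_trans _ _ (E * K * F * (t ^+ 3 + (a ^+ 3 + t * a ^+ 2 + t ^+ 2 / 2 * a)))).
  rewrite mulrDr [leLHS](_ : _ = E * K * F * t ^+ 3 +
    E * K * 1 * (a ^+ 3 + t * a ^+ 2 + t ^+ 2 / 2 * a)); last by field.
  rewrite lerD2l ler_wpM2r// ?ler_wpM2l//.
  by rewrite !addr_ge0// ?mulr_ge0// ?exprn_ge0.
rewrite [leRHS](_ : _ = E * K * F * (a + t) ^+ 3); last by ring.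
rewrite ler_wpM2l//; first by rewrite mulr_ge0// ltW ?expR_gt0.
rewrite -subr_ge0 [leRHS](_ : _ = 2 * (t * a ^+ 2) + (5 / 2) * (t ^+ 2 * a)); last by field.
by rewrite addr_ge0 ?mulr_ge0 ?exprn_ge0.
Qed.

End Flows.

(** * The Ninomiya-Victoir splitting of a semigroup *)

Section Splitting.
Set Implicit Arguments.
Unset Strict Implicit.
Unset Printing Implicit Defensive.
Variables (R : realType) (V : lmodType R) (N : V -> \bar R) (B : set V).
Hypothesis NB : normed_subspace N B.
Variable d : nat.

Lemma pseudocontractive_exp_bounded (P : R -> V -> V) (omega Om : R) :
  is_C0_semigroup N B P ->
  (forall t f, 0 <= t -> B f -> (N (P t f) <= (expR (omega * t))%:E * N f)%E) ->
  omega <= Om -> exp_bounded_semigroup N B Om P.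
Proof.
move=> C0 bnd oO; split => // t u c t0 Bu c0 uc.
apply: le_trans (bnd _ _ t0 Bu) _.
apply: (@le_trans _ _ ((expR (omega * t))%:E * c%:E)%E).
  by apply: lee_wpmul2l; rewrite // lee_fin expR_ge0.
by rewrite -EFinM lee_fin ler_wpM2r// ler_expR ler_wpM2r.
Qed.

Section OneStep.
Variables (Om : R) (Om_ge0 : 0 <= Om).
Variables (P : R -> V -> V) (Ps : 'I_d.+1 -> R -> V -> V).
Hypothesis hP : exp_bounded_semigroup N B Om P.
Hypothesis hPs : forall j, exp_bounded_semigroup N B Om (Ps j).

(** The first of the two products in a splitting step; its reversal is the
    second one, as the half steps at both ends coincide. *)
Definition nv_word (dt : R) : seq ('I_d.+1 * R) :=
  (ord0, dt / 2) ::
  rcons [seq (lift ord0 j, dt) | j <- enum 'I_d] (ord0, dt / 2).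

Lemma rev_nv_word dt : rev (nv_word dt) =
  (ord0, dt / 2) ::
  rcons (rev [seq (lift ord0 j, dt) | j <- enum 'I_d]) (ord0, dt / 2).
Proof. by rewrite /nv_word rev_cons rev_rcons. Qed.

Lemma nv_word_ge0 dt : 0 <= dt -> nonneg_word (nv_word dt).
Proof.
move=> dt0; have dt2 : 0 <= dt / 2 by rewrite divr_ge0.
rewrite /nv_word /nonneg_word /= all_rcons /= dt2 /=.
by apply/allP => x /mapP[j _ ->].
Qed.

Lemma rev_nv_word_ge0 dt : 0 <= dt -> nonneg_word (rev (nv_word dt)).
Proof. by move=> dt0; rewrite /nonneg_word all_rev; exact: nv_word_ge0. Qed.

Lemma weight1_nv_word dt j : weight1 (nv_word dt) j = dt.
Proof.
rewrite /nv_word weight1_cons /weight1 -cats1 big_cat big_seq1 big_map /=.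
rewrite big_enum /=; case: (unliftP ord0 j) => [i|] ->.
  rewrite (bigD1 i)//= eqxx mul1r big1 => [|k ki]; first by rewrite !mul0r; ring.
  by rewrite (inj_eq lift_inj) (negbTE ki) mul0r.
rewrite eqxx !mul1r big1 => [|k _]; first by rewrite add0r -splitr.
by rewrite eq_sym (negbTE (neq_lift _ _)) mul0r.
Qed.

Lemma duration_nv_word dt : duration (nv_word dt) = d.+1%:R * dt.
Proof.
rewrite -sum_weight1 (eq_bigr (fun=> dt)) => [|j _]; last exact: weight1_nv_word.
by rewrite sumr_const card_ord mulr_natl.
Qed.

Lemma ninomiya_victoirE dt u : 0 <= dt -> B u ->
  ninomiya_victoir Ps dt u =
  2^-1 *: (flow Ps (nv_word dt) u + flow Ps (rev (nv_word dt)) u).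
Proof.
move=> dt0 Bu; have dt2 : 0 <= dt / 2 by rewrite divr_ge0.
have compE (s : seq 'I_d) v : foldr (fun a b => a \o b) id
    [seq Ps (lift ord0 j) dt | j <- s] v =
    flow Ps [seq (lift ord0 j, dt) | j <- s] v.
  by elim: s => [//|j s IH]; rewrite /= IH.
have Bs (s : seq 'I_d) v : B v -> B (flow Ps [seq (lift ord0 j, dt) | j <- s] v).
  by apply: (flow_sub hPs); apply/allP => x /mapP[j _ ->].
have BP0 : B (Ps ord0 (dt / 2) u) by exact: (semigroup_sub (hPs _)).
rewrite rev_nv_word /nv_word /ninomiya_victoir -!map_rev !compE.
by rewrite (semigroupD (hPs _))//; [rewrite /flow /= !foldr_rcons|exact: Bs..].
Qed.

Lemma ninomiya_victoir_sub dt u : 0 <= dt -> B u -> B (ninomiya_victoir Ps dt u).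
Proof.
move=> dt0 Bu; rewrite ninomiya_victoirE//.
apply: (subspaceZ NB); apply: (subspaceD NB); apply: (flow_sub hPs) => //.
  exact: nv_word_ge0.
exact: rev_nv_word_ge0.
Qed.

Lemma half_sum_close u u' v v' (c : R) :
  norm_close N u v c -> norm_close N u' v' c ->
  norm_close N (2^-1 *: (u + u')) (2^-1 *: (v + v')) c.
Proof.
move=> uv uv'; have h : (0 : R) <= 2^-1 by [].
have := norm_closeZ NB h (norm_closeD NB uv uv').
by apply: norm_close_le; rewrite mulrC mulrDl -splitr.
Qed.

Lemma ninomiya_victoir_stable dt u v c : 0 <= dt -> B u -> B v -> 0 <= c ->
  norm_close N u v c ->
  norm_close N (ninomiya_victoir Ps dt u) (ninomiya_victoir Ps dt v)
    (expR (Om * (d.+1%:R * dt)) * c).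
Proof.
move=> dt0 Bu Bv c0 uv; rewrite !ninomiya_victoirE//; apply: half_sum_close.
  rewrite -duration_nv_word.
  exact: (flow_norm_close NB hPs (nv_word_ge0 dt0)).
rewrite -duration_nv_word -duration_rev.
exact: (flow_norm_close NB hPs (rev_nv_word_ge0 dt0)).
Qed.

(** The averaged expansion agrees with that of the exponential of
    [dt (\sum_i G_i)]: every index has total time [dt] in the word. *)
Lemma taylor2_nv_average (u : V) (D1 : 'I_d.+1 -> V)
    (D2 : 'I_d.+1 -> 'I_d.+1 -> V) dt :
  2^-1 *: (taylor2 u D1 D2 (nv_word dt) + taylor2 u D1 D2 (rev (nv_word dt))) =
  u + dt *: (\sum_i D1 i) + (dt ^+ 2 / 2) *: \sum_i \sum_j D2 i j.
Proof.
have half (v : V) : 2^-1 *: (v + v) = v.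
  rewrite scalerDr -scalerDl (_ : 2^-1 + 2^-1 = 1 :> R) ?scale1r//.
  by field.
move: (nv_word dt) (weight1_nv_word dt) => w w1.
rewrite /taylor2.
have -> : \sum_i weight1 (rev w) i *: D1 i = dt *: \sum_i D1 i.
  by rewrite scaler_sumr; apply: eq_bigr => i _; rewrite weight1_rev w1.
have -> : \sum_i weight1 w i *: D1 i = dt *: \sum_i D1 i.
  by rewrite scaler_sumr; apply: eq_bigr => i _; rewrite w1.
rewrite addrACA scalerDr half; congr (_ + _).
rewrite -big_split /= scaler_sumr pair_bigA scaler_sumr /=.
apply: eq_bigr => p _; rewrite -scalerDl scalerA weight2_rev_average.
by rewrite !w1 mulrC expr2.
Qed.

(** The factor 2 stands for two remainders of the same size: that of Taylor's
    formula for [P], whose third image is a sum of [(d + 1) ^ 3] terms, and that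
    of the products, whose total time is [(d + 1) dt]. *)
Lemma ninomiya_victoir_local_error dt (K : R) u D1 D2 D3 z :
  0 <= dt -> 0 <= K -> B u -> jet3 N B Ps K u D1 D2 D3 ->
  derivative0 N B P u (\sum_i D1 i) ->
  derivative0 N B P (\sum_i D1 i) (\sum_i \sum_j D2 i j) ->
  derivative0 N B P (\sum_i \sum_j D2 i j) z ->
  norm_le N z (d.+1%:R ^+ 3 * K) ->
  norm_close N (P dt u) (ninomiya_victoir Ps dt u)
    (2 * d.+1%:R ^+ 3 * K * expR (Om * (d.+1%:R * dt)) * dt ^+ 3).
Proof.
move=> dt0 K0 Bu J h1 h2 h3 zK.
have dK0 : 0 <= d.+1%:R ^+ 3 * K by rewrite mulr_ge0.
have hPdt := taylor_order3 NB Om_ge0 hP h1 h2 h3 dt0 dK0 zK.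
have w0 := nv_word_ge0 dt0; have w0' := rev_nv_word_ge0 dt0.
have F := flow_taylor NB Om_ge0 hPs K0 Bu J w0.
have F' := flow_taylor NB Om_ge0 hPs K0 Bu J w0'.
rewrite duration_rev in F'.
have := half_sum_close F F'; rewrite taylor2_nv_average -ninomiya_victoirE//.
rewrite duration_nv_word => /(norm_close_sym NB) /(norm_close_trans NB hPdt).
apply: norm_close_le; set E := expR (Om * (d.+1%:R * dt)).
have E1 : expR (Om * dt) <= E.
  by rewrite ler_expR ler_wpM2l// ler_peMl// ler1n.
rewrite [leRHS](_ : _ = dt ^+ 3 * (E * (d.+1%:R ^+ 3 * K)) +
  E * K * (d.+1%:R * dt) ^+ 3); last by ring.
by rewrite lerD2r ler_wpM2l ?exprn_ge0// ler_wpM2r.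
Qed.

(** Replacing one exact step at a time by [Q] gives [n] local errors, each
    magnified by at most [rho ^+ n]. *)
Lemma telescoping_error (Q : V -> V) f dt (rho eps : R) (n : nat) :
  0 <= dt -> 1 <= rho -> 0 <= eps -> B f ->
  (forall u, B u -> B (Q u)) ->
  (forall u v c, B u -> B v -> 0 <= c -> norm_close N u v c ->
     norm_close N (Q u) (Q v) (rho * c)) ->
  (forall k, (k < n)%N ->
     norm_close N (P dt (P (k%:R * dt) f)) (Q (P (k%:R * dt) f)) eps) ->
  norm_close N (P (n%:R * dt) f) (iter n Q f) (n%:R * rho ^+ n * eps).
Proof.
move=> dt0 rho1 eps0 Bf BQ Qlip; elim: n => [_|n IH err].
  by rewrite mul0r (semigroup_at0 hP)//= !mul0r; exact: (norm_close_refl NB).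
have Biter m : B (iter m Q f) by elim: m => //= m; exact: BQ.
have ndt0 : 0 <= n%:R * dt by rewrite mulr_ge0.
have rho0 : 0 <= rho by rewrite (le_trans _ rho1).
have {}IH := IH (fun k kn => err k (ltnW kn)).
have BPn : B (P (n%:R * dt) f) by exact: (semigroup_sub hP).
have cst0 : 0 <= n%:R * rho ^+ n * eps by rewrite !mulr_ge0// exprn_ge0.
have := norm_close_trans NB (err n (ltnSn n)) (Qlip _ _ _ BPn (Biter n) cst0 IH).
rewrite -(semigroup_add hP)// -[n.+1%:R]natr1 mulrDl mul1r [dt + _]addrC.
apply: norm_close_le.
rewrite [leRHS](_ : _ = rho ^+ n.+1 * eps + rho * (n%:R * rho ^+ n * eps)).
  by rewrite lerD2r ler_peMl// exprn_ege1.
by rewrite exprS; ring.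
Qed.

(** Generators are single-valued, so the values obtained along different
    triples of indices agree, and the images under powers of [\sum_i G_i] are
    sums of the mixed images.  This turns the bound on the triple compositions
    into a bound on the third image under the generator of [P]. *)
Lemma smooth_set_jet (T t K : R) f :
  smooth_set N B P Ps T 3 f -> 0 <= t <= T ->
  (forall js : 3.-tuple 'I_d.+1, exists2 h,
    op_prod [seq generator N B (Ps j) | j <- js] (P t f) h & (N h <= K%:E)%E) ->
  exists D1 D2 D3 z, [/\ jet3 N B Ps K (P t f) D1 D2 D3,
    derivative0 N B P (P t f) (\sum_i D1 i),
    derivative0 N B P (\sum_i D1 i) (\sum_i \sum_j D2 i j),
    derivative0 N B P (\sum_i \sum_j D2 i j) z &
    norm_le N z (d.+1%:R ^+ 3 * K)].
Proof.
move=> [Bf _ _ sums] tT prods; set u := P t f.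
have g0 Q v w : generator N B Q v w -> derivative0 N B Q v w.
  exact: (derivative0_generator NB).
have un Q v w w' : derivative0 N B Q v w -> derivative0 N B Q v w' -> w = w'.
  exact: (derivative0_uniq NB).
have prod3 i j k : exists w1 w2 w3, [/\ derivative0 N B (Ps k) u w1,
    derivative0 N B (Ps j) w1 w2, derivative0 N B (Ps i) w2 w3 & norm_le N w3 K].
  have [w3 [w2 [w1 [_ <- /g0 uw1] /g0 w12] /g0 w23] w3K] := prods [tuple i; j; k].
  by exists w1, w2, w3.
have /choice[D1 hD1] : forall i, exists w, derivative0 N B (Ps i) u w.
  by move=> i; have [w1 [_ [_ [? _ _ _]]]] := prod3 i i i; exists w1.
have /choice[D2 hD2] : forall p : 'I_d.+1 * 'I_d.+1,
    exists w, derivative0 N B (Ps p.1) (D1 p.2) w.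
  move=> [i j] /=; have [w1 [w2 [_ [uw1 w12 _ _]]]] := prod3 i i j.
  by exists w2; rewrite (un _ _ _ _ (hD1 j) uw1).
have /choice[D3 hD3] : forall p : 'I_d.+1 * ('I_d.+1 * 'I_d.+1),
    exists w, derivative0 N B (Ps p.1) (D2 p.2) w /\ norm_le N w K.
  move=> [i [j k]] /=; have [w1 [w2 [w3 [uw1 w12 w23 w3K]]]] := prod3 i j k.
  have w1E := un _ _ _ _ (hD1 k) uw1; rewrite -w1E in w12.
  by exists w3; rewrite (un _ _ _ _ (hD2 (j, k)) w12).
pose h1 := \sum_i D1 i; pose h2 := \sum_i \sum_j D2 (i, j).
have opsum v w (vs : 'I_d.+1 -> V) : (forall j, derivative0 N B (Ps j) v (vs j)) ->
    op_sum (fun j => generator N B (Ps j)) v w -> w = \sum_j vs j.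
  move=> vvs [g vg ->]; apply: eq_bigr => j _.
  exact: un (g0 _ _ _ (vg j)) (vvs j).
have sum1 w : op_sum (fun j => generator N B (Ps j)) u w -> w = h1.
  exact: opsum.
have sum2 w : op_sum (fun j => generator N B (Ps j)) h1 w -> w = h2.
  by apply: opsum => i; apply: (derivative0_sum NB (hPs i)) => j; exact: hD2 (i, j).
have sum3 w : op_sum (fun j => generator N B (Ps j)) h2 w ->
    w = \sum_i \sum_j \sum_k D3 (i, (j, k)).
  apply: opsum => i; apply: (derivative0_sum NB (hPs i)) => j.
  apply: (derivative0_sum NB (hPs i)) => k; exact: (hD3 (i, (j, k))).1.
have Gh1 : derivative0 N B P u h1.
  have [w [_ <- /g0 uw] [_ <- /sum1 wh1]] := sums 1%N t isT tT.
  by rewrite -wh1.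
have Gh2 : derivative0 N B P h1 h2.
  have [w [w1 [_ <- /g0 uw1] /g0 w1w] [_ [_ <- /sum1 ->] /sum2 wh2]] :=
    sums 2%N t isT tT.
  by rewrite -wh2 (un _ _ _ _ Gh1 uw1).
have [z [w2 [w1 [_ <- /g0 uw1] /g0 w12] /g0 w2z]] := sums 3%N t isT tT.
move=> [_ [_ [_ <- /sum1 ->] /sum2 ->] /sum3 zE].
have w1E := un _ _ _ _ Gh1 uw1; rewrite -w1E in w12.
have w2E := un _ _ _ _ Gh2 w12; rewrite -w2E in w2z.
exists D1, (fun i j => D2 (i, j)), (fun i j k => D3 (i, (j, k))), z; split => //.
  split => [//|i j|i j k|i j k]; first exact: hD2 (i, j).
    by have [] := hD3 (i, (j, k)).
  by have [] := hD3 (i, (j, k)).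
rewrite zE (_ : _ * K = \sum_(i < d.+1) \sum_(j < d.+1) \sum_(k < d.+1) K).
  apply: (norm_le_sum NB) => i; apply: (norm_le_sum NB) => j.
  by apply: (norm_le_sum NB) => k; have [] := hD3 (i, (j, k)).
by rewrite !sumr_const card_ord -!mulrnA -natrX mulr_natl.
Qed.

End OneStep.

Theorem ninomiya_victoir_order2 (P : R -> V -> V) (Ps : 'I_d.+1 -> R -> V -> V)
    (T : R) f :
  is_pseudocontractive_semigroup N B P ->
  (forall j, is_pseudocontractive_semigroup N B (Ps j)) ->
  smooth_set N B P Ps T 3 f ->
  exists C : R, forall (n : nat) (dt : R), 0 < dt -> n%:R * dt <= T ->
    (N (P (n%:R * dt) f - iter n (ninomiya_victoir Ps dt) f)%R
       <= (C * dt ^+ 2)%R%:E)%E.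
Proof.
move=> [P_C0 [om P_om]] Ps_pseudo f_smooth.
have /choice[oms Ps_om] : forall j, exists om : R, forall t u, 0 <= t -> B u ->
    (N (Ps j t u) <= (expR (om * t))%:E * N u)%E.
  by move=> j; have [_] := Ps_pseudo j.
(* A common growth rate for all the semigroups. *)
pose Om := `|om| + \sum_j `|oms j|.
have sum0 : 0 <= \sum_j `|oms j| by exact: sumr_ge0.
have Om0 : 0 <= Om by exact: addr_ge0.
have hP : exp_bounded_semigroup N B Om P.
  apply: (pseudocontractive_exp_bounded P_C0 P_om).
  by rewrite (le_trans (ler_norm _))// lerDl.
have hPs j : exp_bounded_semigroup N B Om (Ps j).
  apply: (pseudocontractive_exp_bounded (Ps_pseudo j).1 (Ps_om j)).
  rewrite (le_trans (ler_norm _))// /Om (bigD1 j)//= addrCA lerDl.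
  by rewrite addr_ge0// sumr_ge0.
have [Bf _ [K0 f_prods] _] := f_smooth.
pose K := Num.max K0 0.
have K_ge0 : 0 <= K by rewrite le_max lexx orbT.
pose D : R := d.+1%:R; have D1 : 1 <= D by rewrite ler1n.
exists (T * expR (Om * (D * T)) * (2 * D ^+ 3 * K * expR (Om * (D * T)))).
have C0 : 0 <= 2 * D ^+ 3 * K * expR (Om * (D * T)).
  by rewrite !mulr_ge0 ?exprn_ge0 ?expR_ge0// (le_trans _ D1).
move=> n dt dt0 ndt.
have dt_ge0 := ltW dt0; have D0 : 0 <= D := le_trans ler01 D1.
pose rho := expR (Om * (D * dt)).
have rho1 : 1 <= rho by rewrite -expR0 ler_expR !mulr_ge0.
pose eps := 2 * D ^+ 3 * K * expR (Om * (D * T)) * dt ^+ 3.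
have eps0 : 0 <= eps by rewrite mulr_ge0// exprn_ge0.
have T0 : 0 <= T by rewrite (le_trans _ ndt)// mulr_ge0.
have local_error k : (k < n)%N ->
    norm_close N (P dt (P (k%:R * dt) f))
      (ninomiya_victoir Ps dt (P (k%:R * dt) f)) eps.
  move=> kn; have kdt0 : 0 <= k%:R * dt by rewrite mulr_ge0.
  have dtT : dt <= T.
    by rewrite (le_trans _ ndt)// ler_peMl// ler1n (leq_ltn_trans _ kn).
  have kdtT : 0 <= k%:R * dt <= T.
    by rewrite kdt0 (le_trans _ ndt)// ler_wpM2r// ler_nat ltnW.
  have prods (js : 3.-tuple 'I_d.+1) : exists2 h,
      op_prod [seq generator N B (Ps j) | j <- js] (P (k%:R * dt) f) h &
      (N h <= K%:E)%E.
    have [h fh hK] := f_prods _ kdtT js; exists h => //.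
    by rewrite (le_trans hK)// lee_fin le_max lexx.
  have [E1 [E2 [E3 [z [J h1 h2 h3 zK]]]]] :=
    smooth_set_jet hPs f_smooth kdtT prods.
  have BPk : B (P (k%:R * dt) f) by exact: (semigroup_sub hP).
  have := ninomiya_victoir_local_error Om0 hP hPs dt_ge0 K_ge0 BPk J h1 h2 h3 zK.
  apply: norm_close_le; rewrite /eps ler_wpM2r ?exprn_ge0// ler_wpM2l//.
    by rewrite !mulr_ge0// exprn_ge0.
  by rewrite ler_expR !ler_wpM2l.
have := telescoping_error hP dt_ge0 rho1 eps0 Bf
  (fun u => ninomiya_victoir_sub hPs dt_ge0 (u := u))
  (fun u v c => ninomiya_victoir_stable hPs dt_ge0 (u := u) (v := v) (c := c))
  local_error.
apply: norm_close_le.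
rewrite [leLHS](_ : _ = n%:R * dt * rho ^+ n *
  (2 * D ^+ 3 * K * expR (Om * (D * T))) * dt ^+ 2); last by rewrite /eps; ring.
rewrite ler_wpM2r ?exprn_ge0// ler_wpM2r// ler_pM ?mulr_ge0 ?exprn_ge0 ?expR_ge0//.
rewrite /rho -expRM_natl ler_expR.
rewrite [leLHS](_ : _ = Om * (D * (n%:R * dt))); last by ring.
by rewrite !ler_wpM2l.
Qed.

End Splitting.

(** * The weighted space of functions *)

Section WeightedSpace.
Set Implicit Arguments.
Unset Strict Implicit.
Unset Printing Implicit Defensive.
Variables (R : realType) (X : completeNormedModType R).
Variables (A : X -> X) (D : set X) (l : nat) (s : R).
Hypothesis s_ge0 : 0 <= s.
Implicit Types f g : X -> R^o.

Lemma psi_ge1 x : 1 <= psi A l s x.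
Proof.
rewrite /psi -[leLHS](powRr0 (1 + norm_pow A l x ^+ 2)).
apply: ler_powR; last by rewrite divr_ge0.
by rewrite lerDl sqr_ge0.
Qed.

Lemma psi_gt0 x : 0 < psi A l s x.
Proof. exact: lt_le_trans ltr01 (psi_ge1 x). Qed.

Lemma wnorm_leP f c : norm_le (wnorm A D l s) f c <->
  forall x, dom_pow A D l x -> `|f x| <= c * psi A l s x.
Proof.
split=> [fc x Dx|fc].
  have : (((psi A l s x)^-1 * `|f x|)%:E <= c%:E)%E.
    by apply: le_trans fc; apply: ereal_sup_ubound; exists x.
  by rewrite lee_fin mulrC ler_pdivrMr ?psi_gt0.
apply: ge_ereal_sup => _ [x Dx <-].
by rewrite lee_fin mulrC ler_pdivrMr ?psi_gt0//; exact: fc.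
Qed.

Lemma weakly_continuous_lin (c : R) f g :
  weakly_continuous A D l f -> weakly_continuous A D l g ->
  weakly_continuous A D l (c *: f + g).
Proof.
move=> cf cg x e Dx e0.
have c0 : 0 < `|c| + 1 by rewrite ltr_wpDl.
have e2 : 0 < e / (`|c| + 1) / 2 by rewrite !divr_gt0.
have [ps [dp [dp0 ps_fun fe]]] := cf x _ Dx e2.
have [qs [dq [dq0 qs_fun ge]]] := cg x _ Dx (divr_gt0 e0 (ltr0n _ 2)).
exists (ps ++ qs), (Num.min dp dq); split.
- by rewrite lt_min dp0.
- move=> i; rewrite size_cat nth_cat; case: (ltnP i (size ps)) => [ip _|ip iq]; first exact: ps_fun.
  by apply: qs_fun; rewrite ltn_subLR.
- move=> y Dy yx.
  have fy : `|f y - f x| < e / (`|c| + 1) / 2.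
    apply: fe => // i ip; have := yx i.
    rewrite size_cat nth_cat ip => /(_ (ltn_addr _ ip)) /lt_le_trans; apply.
    by rewrite ge_min lexx.
  have gy : `|g y - g x| < e / 2.
    apply: ge => // i iq; have := yx (size ps + i)%N.
    rewrite size_cat nth_cat (ltnNge _ (size ps)) leq_addr /= addKn ltn_add2l.
    move=> /(_ iq) /lt_le_trans; apply.
    by rewrite ge_min lexx orbT.
  rewrite [X in `|X|](_ : _ = c * (f y - f x) + (g y - g x)); last first.
    by rewrite /= !fctE /GRing.scale /=; ring.
  rewrite (le_lt_trans (ler_normD _ _))// [ltRHS]splitr ler_ltD// normrM.
  rewrite (le_trans (ler_wpM2l (normr_ge0 c) (ltW fy)))//.
  rewrite mulrA ler_pM2r// mulrA ler_pdivrMr// [e * _]mulrC ler_pM2r//.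
  by rewrite lerDl.
Qed.

(** The weight is at least 1, so bounded functions have finite norm; and
    functions that vanish outside [dom A^l] are determined by their values on
    it, so the norm separates them. *)
Lemma Bpsi_normed_subspace : normed_subspace (wnorm A D l s) (Bpsi A D l s).
Proof.
have nD f g a b : norm_le (wnorm A D l s) f a -> norm_le (wnorm A D l s) g b ->
    norm_le (wnorm A D l s) (f + g) (a + b).
  move=> /wnorm_leP fa /wnorm_leP gb; apply/wnorm_leP => x Dx.
  by rewrite mulrDl (le_trans (ler_normD _ _))// lerD ?fa ?gb.
have nZ c f a : norm_le (wnorm A D l s) f a ->
    norm_le (wnorm A D l s) (c *: f) (`|c| * a).
  move=> /wnorm_leP fa; apply/wnorm_leP => x Dx.
  by rewrite normrM -mulrA ler_wpM2l// fa.
split => //.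
- move=> f [_ /(_ 1 ltr01)[g [[M gM] _ fg]]]; exists (1 + Num.max M 0).
  rewrite -[f](subrK g); apply: nD => //; apply/wnorm_leP => x Dx.
  rewrite (le_trans (gM x Dx))// (@le_trans _ _ (Num.max M 0))//.
    by rewrite le_max lexx.
  by rewrite ler_peMr ?psi_ge1// le_max lexx orbT.
- move=> f [f0 _] /wnorm_leP fN; apply/funext => x.
  have [Dx|nDx] := pselect (dom_pow A D l x); last exact: f0.
  by apply/eqP; rewrite -normr_le0 -(mul0r (psi A l s x)) fN.
- split=> // e e0; exists 0; split.
  + by exists 0 => x _; rewrite normr0.
  + move=> x r _ r0; exists [::], 1; split => // y _ _.
    by rewrite subrr normr0.
  + rewrite subr0; apply/wnorm_leP => x _.
    by rewrite normr0 mulr_ge0 ?ltW// psi_gt0.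
- move=> c f g [f0 fB] [g0 gB]; split.
    by move=> x nDx; rewrite !fctE f0// g0// scaler0 addr0.
  move=> e e0.
  have c0 : 0 < `|c| + 1 by rewrite ltr_wpDl.
  have e2 : 0 < e / (`|c| + 1) / 2 by rewrite !divr_gt0.
  have [f' [[M fM] cf ff]] := fB _ e2.
  have [g' [[M' gM] cg gg]] := gB _ (divr_gt0 e0 (ltr0n _ 2)).
  exists (c *: f' + g'); split.
  + exists (`|c| * M + M') => x Dx.
    rewrite (le_trans (ler_normD _ _))// lerD ?gM// normrM.
    by rewrite ler_wpM2l// fM.
  + exact: weakly_continuous_lin.
  + rewrite [X in wnorm _ _ _ _ X](_ : _ = c *: (f - f') + (g - g')); last first.
      by rewrite scalerBr opprD addrACA.
    have := nD _ _ _ _ (nZ c _ _ ff) gg.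
    apply: norm_le_trans; rewrite [leRHS]splitr lerD2r.
    rewrite mulrA ler_pM2r// mulrA ler_pdivrMr// [e * _]mulrC ler_pM2r//.
    by rewrite lerDl.
Qed.

End WeightedSpace.

Theorem corollary7p11
  (R : realType) (X : completeNormedModType R)
  (disp : measure_display) (Omega : measurableType disp)
  (Pr : probability Omega R)
  (A : X -> X) (D : set X) (S : R -> X -> X)
  (m d : nat) (alpha : X -> X) (sigma : 'I_d -> X -> X)
  (F : R -> set (set Omega)) (W : 'I_d -> R -> Omega -> R)
  (x : R -> X -> Omega -> X) (z0 : R -> X -> X)
  (z : 'I_d -> R -> X -> Omega -> X)
  (l0 : nat) (s0 : R) (T : R)
  (X_hilbert : is_hilbert X) (X_separable : is_separable X)
  (S_semigroup : is_pseudocontractive_semigroup (@normE R X) setT S)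
  (A_generates : generates A D S)
  (A_resolvent : has_compact_resolvent A D)
  (m_ge1 : (1 <= m)%N)
  (alpha_lipschitz : forall l, (l <= m)%N -> lipschitz_dom_pow A D l alpha)
  (sigma_lipschitz : forall j l, (l <= m)%N ->
     lipschitz_dom_pow A D l (sigma j))
  (sigma_C1 : forall j, C1_bounded_derivative (sigma j))
  (F_filtration : is_filtration F)
  (W_brownian : is_brownian_motion Pr F W)
  (x_solution : forall x0,
     is_mild_solution Pr F W S alpha sigma x0 (fun t => x t x0))
  (z0_solution : forall x0,
     is_mild_ode_solution S (stratonovich_drift alpha sigma) x0
       (fun t => z0 t x0))
  (z_solution : forall j x0,
     is_stratonovich_solution Pr F (W j) (sigma j) x0 (fun t => z j t x0))
  (l0_lt_m : (l0 < m)%N) (s0_ge2 : 2 <= s0)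
  (N := wnorm A D l0 s0) (B := Bpsi A D l0 s0)
  (P := transition Pr (dom_pow A D l0) x)
  (Ps := split_transition Pr (dom_pow A D l0) z0 z)
  (P_semigroup : is_pseudocontractive_semigroup N B P)
  (Ps_semigroup : forall j, is_pseudocontractive_semigroup N B (Ps j))
  (T_gt0 : 0 < T) :
  forall f, smooth_set N B P Ps T 3 f ->
  exists C : R, forall (n : nat) (dt : R), 0 < dt -> n%:R * dt <= T ->
    (N (P (n%:R * dt) f - iter n (ninomiya_victoir Ps dt) f)%R
       <= (C * dt ^+ 2)%R%:E)%E.
Proof.
have NB := Bpsi_normed_subspace A D l0 (le_trans (ler0n _ 2) s0_ge2).
move=> f f_smooth.
exact: (ninomiya_victoir_order2 NB P_semigroup Ps_semigroup f_smooth).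
Qed.
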